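(* Let $f$ be a symmetric nontrivial tradeoff function. There is a unique discrete CND for $f$ at sensitivity $\Delta=1$. Furthermore, it can be realized by rounding any (continuous) CND for $f$ (i.e., as the distribution of $\mathrm{round}(N_c)$ for any CND $N_c$ for $f$), and it has probability mass function $$P(N=x)=f^{\circ|x|}(1-c_f)-f^{\circ|x|}(c_f),\qquad x\in\mathbb{Z}.$$
   Context: For probability distributions $P,Q$ on a common measurable space, the tradeoff function $T(P,Q):[0,1]\to[0,1]$ is $T(P,Q)(\alpha)=\inf\{1-\mathbb{E}_Q(\phi)\mid \mathbb{E}_P(\phi)\leq 1-\alpha\}$, the infimum over measurable tests $\phi$ with values in $[0,1]$. For random variables $X,Y$, $T(X,Y)$ denotes the tradeoff function of their laws. A function $f:[0,1]\to[0,1]$ is a tradeoff function if $f=T(P,Q)$ for some $P,Q$; equivalently, $f$ is convex, continuous, non-decreasing, and $f(x)\leq x$ for all $x\in[0,1]$. It is nontrivial if $f(\alpha)<\alpha$ for some $\alpha\in(0,1)$, and symmetric if $f=T(P,Q)$ implies $f=T(Q,P)$. Inequalities between functions are pointwise. For a symmetric tradeoff function $f$, $c_f$ is the unique value with $f(1-c_f)=c_f$. $f^{\circ k}=f\circ\cdots\circ f$ ($k$ times), with $f^{\circ 0}$ the identity. Canonical noise distribution: let $f$ be a symmetric tradeoff function and $N$ a continuous real random variable (continuous cdf) with cdf $F$. Then $F$ (or $N$) is a canonical noise distribution (CND) for $f$ if (1) $T(N,N+m)\geq f$ for all $m\in[0,1]$; (2) $f(\alpha)=T(N,N+1)(\alpha)$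 for all $\alpha\in(0,1)$; (3) $T(N,N+1)(\alpha)=F(F^{-1}(\alpha)-1)$ for all $\alpha\in(0,1)$, where $F^{-1}$ is the quantile function; (4) $F(x)=1-F(-x)$ for all $x\in\mathbb{R}$. It is known (Awan and Vadhan, 2023) that every symmetric nontrivial tradeoff function has a CND. Discrete CND: let $\Delta$ be a positive integer, $f$ a symmetric tradeoff function, and $N$ a random variable with cdf $F$. Then $F$ (or $N$) is a discrete CND for $f$ at sensitivity $\Delta$ if (1) $T(N,N+t)\geq f$ for all $t\in\{-\Delta,\ldots,\Delta\}$; (2) $f(F(t+\Delta))=F(t)$ for all $t\in\mathbb{Z}$ such that $F(t+\Delta)<1$; (3) $N$ takes values in $\mathbb{Z}$ and is symmetric about zero (i.e. $N$ and $-N$ have the same distribution). $\mathrm{round}(t)=\lfloor t+1/2\rfloor$. *)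

(* Defs.v *)
From HB Require Import structures.
From mathcomp Require Import all_boot all_order all_algebra.
From mathcomp Require Import all_classical all_reals all_analysis.
From mathcomp Require Import measurable_realfun.

Set Implicit Arguments.
Unset Strict Implicit.
Unset Printing Implicit Defensive.

Import Order.TTheory GRing.Theory Num.Theory.
Import numFieldNormedType.Exports.

Local Open Scope classical_set_scope.
Local Open Scope ring_scope.

(* Functions [0,1] -> [0,1] are represented by functions R -> R; only their
   values on [0,1] are ever constrained or used. *)

Section Tradeoff.
Context {R : realType}.

(* The set is nonempty and bounded below when 0 <= a <= 1, so that inf is the
   infimum there. *)
Definition tradeoff d (T : measurableType d) (P Q : probability T R) (a : R) : R :=
  inf [set b | exists phi : {mfun T >-> R},
    [/\ forall t, 0 <= phi t <= 1,
        ('E_P[phi] <= (1 - a)%:E)%E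
      & b = 1 - fine 'E_Q[phi]] ].

Definition is_tradeoff_of d (T : measurableType d) (P Q : probability T R)
    (f : R -> R) : Prop :=
  forall a, 0 <= a <= 1 -> f a = tradeoff P Q a.

Definition is_tradeoff (f : R -> R) : Prop :=
  exists (d : measure_display) (T : measurableType d) (P Q : probability T R),
    is_tradeoff_of P Q f.

Definition symmetric_tradeoff (f : R -> R) : Prop :=
  forall (d : measure_display) (T : measurableType d) (P Q : probability T R),
    is_tradeoff_of P Q f -> is_tradeoff_of Q P f.

Definition nontrivial_tradeoff (f : R -> R) : Prop :=
  exists2 a, 0 < a < 1 & f a < a.

(* For a symmetric tradeoff function there is exactly one such c. *)
Definition c_of (f : R -> R) : R :=
  xget 0 [set c | 0 <= c <= 1 /\ f (1 - c) = c].

End Tradeoff.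

Section RandomVariables.
Context {R : realType}.

Definition rv_tradeoff d (T : measurableType d) (P : probability T R)
    (X Y : {RV P >-> R}) : R -> R :=
  tradeoff (distribution P X) (distribution P Y).

Definition rv_shift d (T : measurableType d) (P : probability T R)
    (X : {RV P >-> R}) (m : R) : {RV P >-> R} :=
  ((X : {mfun T >-> R}) + (cst m : {mfun T >-> R})).

Definition rv_opp d (T : measurableType d) (P : probability T R)
    (X : {RV P >-> R}) : {RV P >-> R} :=
  (- (X : {mfun T >-> R})).

(* Compared on measurable sets only: a probability is a total function on sets,
   whose values on non-measurable sets are irrelevant. *)
Definition same_distribution d d' (T : measurableType d) (T' : measurableType d')
    (P : probability T R) (P' : probability T' R)
    (X : {RV P >-> R}) (Y : {RV P' >-> R}) : Prop :=
  forall A : set R, measurable A -> distribution P X A = distribution P' Y A.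

Definition rcdf d (T : measurableType d) (P : probability T R)
    (X : {RV P >-> R}) (x : R) : R := fine (cdf X x).

Definition quantile (F : R -> R) (a : R) : R := inf [set x | a <= F x].

Definition is_CND d (T : measurableType d) (P : probability T R)
    (f : R -> R) (N : {RV P >-> R}) : Prop :=
  let F := rcdf N in
  [/\ continuous F,
      forall m, 0 <= m <= 1 ->
        forall a, 0 <= a <= 1 -> f a <= rv_tradeoff N (rv_shift N m) a,
      forall a, 0 < a < 1 -> f a = rv_tradeoff N (rv_shift N 1) a,
      forall a, 0 < a < 1 ->
        rv_tradeoff N (rv_shift N 1) a = F (quantile F a - 1)
    & forall x, F x = 1 - F (- x)].

(* Delta is meant to be positive.
   Being integer-valued is required almost surely, so that the notion only
   depends on the law of N. *)
Definition is_discrete_CND d (T : measurableType d) (P : probability T R)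
    (f : R -> R) (Delta : nat) (N : {RV P >-> R}) : Prop :=
  let F := rcdf N in
  [/\ forall t : int, - Delta%:Z <= t <= Delta%:Z ->
        forall a, 0 <= a <= 1 -> f a <= rv_tradeoff N (rv_shift N t%:~R) a,
      forall t : int, F (t + Delta%:Z)%:~R < 1 ->
        f (F (t + Delta%:Z)%:~R) = F t%:~R,
      {ae P, forall w, N w \is a Num.int}
    & same_distribution N (rv_opp N)].

Definition round (x : R) : R := (Num.floor (x + 2^-1))%:~R.

Lemma measurable_round : measurable_fun [set: R] round.
Proof.
apply: nondecreasing_measurable => // x y xy.
by rewrite /round ler_int; apply: le_floor; rewrite lerD2r.
Qed.

HB.instance Definition _ :=
  @isMeasurableFun.Build _ _ _ _ round measurable_round.

Definition rv_round d (T : measurableType d) (P : probability T R)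
    (X : {RV P >-> R}) : {RV P >-> R} :=
  (round \o X : {mfun T >-> R}).

End RandomVariables.

(* Main.v *)
(* A discrete CND at sensitivity 1 is determined by its values at the negative
   integers: symmetry and the recurrence at 0 force [F (-1)] to be the fixed
   point [c] of [f (1 - c) = c], and then [F (- k)] is the k-th iterate of [f]
   at [1 - c].  Conversely, [h t := f (1 - t)] being its own generalized inverse
   carries the recurrence over to the positive integers, and makes the
   likelihood ratio of [N + 1] to [N] a slope of the convex function [f], hence
   monotone; the Neyman-Pearson argument then bounds the tradeoff function of
   [N] and [N + 1] below by the chords of [f].  For a continuous CND with cdf
   [F], the recurrence [f (F x) = F (x - 1)] holds for all real [x] with
   [F x < 1], and rounding samples it at the half-integers. *)
Require Import Defs.
From HB Require Import structures.
From mathcomp Require Import all_boot all_order all_algebra.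
From mathcomp Require Import all_classical all_reals all_analysis.
From mathcomp Require Import measurable_realfun.
From mathcomp Require Import ring lra zify.

Set Implicit Arguments.
Unset Strict Implicit.
Unset Printing Implicit Defensive.

Import Order.TTheory GRing.Theory Num.Theory.
Import numFieldNormedType.Exports.

Local Open Scope classical_set_scope.
Local Open Scope ring_scope.

(** * Symmetric tradeoff functions *)

(* In terms of the type II error [h t := f (1 - t)] as a function of the type I
   error [t], [rt_inv] says that [h] is its own generalized inverse. *)
Record regular_tradeoff (R : realType) (f : R -> R) : Prop := RegularTradeoff {
  rt_ge0 : forall x, 0 <= x <= 1 -> 0 <= f x;
  rt_le_id : forall x, 0 <= x <= 1 -> f x <= x;
  rt_homo : forall x y, 0 <= x -> x <= y -> y <= 1 -> f x <= f y;
  rt_convex : forall x y l, 0 <= x <= 1 -> 0 <= y <= 1 -> 0 <= l <= 1 ->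
    f (l * x + (1 - l) * y) <= l * f x + (1 - l) * f y;
  rt_left_cont1 : forall b, (forall x, 0 <= x < 1 -> f x <= b) -> f 1 <= b;
  rt_inv : forall t b, 0 <= t <= 1 -> 0 <= b <= 1 ->
    f (1 - t) < b -> f (1 - b) <= t }.

Section RegularTradeoffTheory.
Variables (R : realType) (f : R -> R).
Hypothesis rf : regular_tradeoff f.

Lemma rt0 : f 0 = 0.
Proof.
have h : 0 <= (0 : R) <= 1 by lra.
by apply/le_anti; rewrite (rt_le_id rf h) (rt_ge0 rf h).
Qed.

(** Convexity with the denominator [z - x] cleared, so that coinciding points need no separate
    treatment by the callers. *)
Lemma rt_slope3 x y z : 0 <= x -> x <= y -> y <= z -> z <= 1 ->
  f y * (z - x) <= f x * (z - y) + f z * (y - x).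
Proof.
move=> x0 xy yz z1.
have [xz|zx] := ltP x z; last first.
  have -> : y = x by lra.
  have -> : z = x by lra.
  lra.
have zx0 : 0 < z - x by lra.
have hl : 0 <= (z - y) / (z - x) <= 1.
  by rewrite divr_ge0 ?ler_pdivrMr//=; lra.
have hx : 0 <= x <= 1 by lra.
have hz : 0 <= z <= 1 by lra.
have := rt_convex rf hx hz hl.
have -> : (z - y) / (z - x) * x + (1 - (z - y) / (z - x)) * z = y.
  by field; lra.
have <- : ((z - y) / (z - x) * f x + (1 - (z - y) / (z - x)) * f z) * (z - x) =
    f x * (z - y) + f z * (y - x) by field; lra.
by rewrite ler_pM2r.
Qed.

(** Slopes of successive chords increase. Both slopes are compared with the slope over the middle
    interval from [y] to [z]; if that interval is degenerate, one three-point inequality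
    suffices. *)
Lemma rt_slope4 x y z w : 0 <= x -> x <= y -> y <= z -> z <= w -> w <= 1 ->
  (f y - f x) * (w - z) <= (f w - f z) * (y - x).
Proof.
move=> x0 xy yz zw w1.
have h1 : f y * (z - x) <= f x * (z - y) + f z * (y - x).
  by apply: rt_slope3; lra.
have h2 : f z * (w - y) <= f y * (w - z) + f w * (z - y).
  by apply: rt_slope3; lra.
have [yltz|zy] := ltP y z; last first.
  have zey : z = y by lra.
  subst z; have := @rt_slope3 x y w x0 xy zw w1; lra.
have zy0 : 0 < z - y by lra.
rewrite -(ler_pM2r zy0).
have h1' : ((f y - f x) * (z - y)) * (w - z) <= ((f z - f y) * (y - x)) * (w - z).
  by apply: ler_wpM2r; lra.
have h2' : ((f z - f y) * (w - z)) * (y - x) <= ((f w - f z) * (z - y)) * (y - x).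
  by apply: ler_wpM2r; lra.
lra.
Qed.

Lemma rt_star u v : 0 <= u -> u <= v -> v <= 1 -> f u * v <= f v * u.
Proof.
by move=> u0 uv v1; have := rt_slope3 (lexx 0) u0 uv v1; rewrite rt0; lra.
Qed.

(** Since [f 0 = 0], convexity makes [f u / u] nondecreasing, so a positive value cannot be taken
    twice. *)
Lemma rt_inj_pos u v : 0 <= u -> u < v -> v <= 1 -> f u = f v -> f v = 0.
Proof.
move=> u0 uv v1 e; have := rt_star u0 (ltW uv) v1; rewrite e => h.
have fv0 : 0 <= f v by apply: rt_ge0 => //; lra.
by apply/le_anti/andP; split => //; nra.
Qed.

(** Below 1 this follows from convexity: [f u] lies under the chord from [u - d] to 1, which exceeds
    [b] by at most [d / (1 - u)]. *)
Lemma rt_left_cont u b : 0 < u -> u <= 1 ->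
  (forall x, 0 <= x < u -> f x <= b) -> f u <= b.
Proof.
move=> u0; rewrite le_eqVlt => /orP[/eqP ->|u1] h; first exact: rt_left_cont1.
have f1 : f 1 <= 1 by apply: rt_le_id => //; lra.
have b0 : 0 <= b by rewrite -rt0; apply: h; lra.
apply/ler_addgt0Pr => e e0.
pose d := Order.min u (e * (1 - u)).
have d0 : 0 < d by rewrite /d lt_min u0 mulr_gt0//; lra.
have du : d <= u by rewrite /d ge_min lexx.
have de : d <= e * (1 - u) by rewrite /d ge_min lexx orbT.
have x0 : 0 <= u - d by lra.
have xu : u - d <= u by lra.
have := rt_slope3 x0 xu (ltW u1) (lexx 1).
have := h (u - d); rewrite x0 /= => /(_ _) hb.
have {}hb : f (u - d) <= b by apply: hb; lra.
have fu0 : 0 <= f u by apply: rt_ge0 => //; lra.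
move=> hs.
have hs2 : f u * (1 - u + d) <= b * (1 - u) + d by nra.
have u10 : 0 < 1 - u by lra.
rewrite -(ler_pM2r u10); nra.
Qed.

(** The limit of [rt_inv] at [t = 1 - z] as [b] decreases to [f z], which left continuity at
    [1 - f z] allows. *)
Lemma rt_inv_le z : 0 <= z <= 1 -> f (1 - f z) <= 1 - z.
Proof.
move=> z01; have fz0 := rt_ge0 rf z01; have fz := rt_le_id rf z01.
have [fz1|fz1] := ltP (f z) 1; last first.
  have -> : 1 - f z = 0 by lra.
  by rewrite rt0; lra.
apply: rt_left_cont => [||x hx]; try lra.
have -> : x = 1 - (1 - x) by ring.
by apply: (rt_inv rf); rewrite ?subKr; lra.
Qed.

(** If the inequality were strict, a [b] halfway between the two sides would satisfy [z < 1 - b]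
    and, by [rt_inv] and monotonicity, [f (1 - b) = f z]: a positive value taken twice. *)
Lemma rt_inv_eq z : 0 <= z <= 1 -> 0 < f z -> f (1 - f z) = 1 - z.
Proof.
move=> z01 fz0; have fz := rt_le_id rf z01.
apply/le_anti; rewrite rt_inv_le//= leNgt; apply/negP => h.
pose b := (f (1 - f z) + (1 - z)) / 2.
have g0 : 0 <= f (1 - f z) by apply: rt_ge0 => //; lra.
have hb : f (1 - b) <= f z by apply: (rt_inv rf); rewrite /b; lra.
have hm : f z <= f (1 - b) by apply: (rt_homo rf); rewrite /b; lra.
have e : f z = f (1 - b) by lra.
have := @rt_inj_pos z (1 - b) ltac:(lra) ltac:(rewrite /b; lra)
  ltac:(rewrite /b; lra) e.
lra.
Qed.

Lemma rt_lt_id x : nontrivial_tradeoff f -> 0 < x < 1 -> f x < x.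
Proof.
move=> [a a01 fa] x01; rewrite ltNge; apply/negP => fx.
have f1 : f 1 <= 1 by apply: rt_le_id => //; lra.
have [ax|xa] := leP a x.
  by have := @rt_slope3 a x 1 ltac:(lra) ax ltac:(lra) ltac:(lra); nra.
by have := @rt_star x a ltac:(lra) ltac:(lra) ltac:(lra); nra.
Qed.

Lemma rt_fix_uniq c c' : 0 <= c <= 1 -> 0 <= c' <= 1 ->
  f (1 - c) = c -> f (1 - c') = c' -> c = c'.
Proof.
wlog le : c c' / c <= c'.
  move=> H c0 c0' e e'; have [cc'|/ltW cc'] := leP c c'; first exact: H.
  by apply/esym/H.
move=> c0 c0' e e'.
by have := @rt_homo _ _ rf (1 - c') (1 - c) ltac:(lra) ltac:(lra) ltac:(lra); lra.
Qed.

Lemma rt_c_of c : 0 <= c <= 1 -> f (1 - c) = c -> c_of f = c.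
Proof.
move=> c01 fc; rewrite /c_of; case: xgetP => [x _ [x01 fx]|/(_ c)[]//].
exact: rt_fix_uniq.
Qed.

(** The crossing of [f] with the decreasing diagonal is the infimum [u] of the points where [f] is
    above it. Left continuity gives [f u <= 1 - u]; the chord from [u] to 1 gives the converse. *)
Lemma rt_fix_exists : exists2 c, 0 <= c <= 1 & f (1 - c) = c.
Proof.
pose A := [set u | 0 <= u <= 1 /\ 1 - u <= f u].
have f1 : 0 <= f 1 by apply: rt_ge0 => //; lra.
have A1 : A 1 by split; lra.
have lbA : lbound A 0 by move=> x [] /andP[].
have iA : has_inf A by split; [exists 1|exists 0].
pose u := inf A.
have u0 : 0 <= u by apply: lb_le_inf => //; exists 1.
have u1 : u <= 1 by apply: ge_inf => //; exists 0.
have lu x : 0 <= x -> x < u -> f x < 1 - x.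
  move=> x0 xu; rewrite ltNge; apply/negP => h.
  suff : u <= x by lra.
  by apply: ge_inf; [exists 0|split; lra].
exists (1 - u); first lra.
have -> : 1 - (1 - u) = u by ring.
apply/le_anti/andP; split.
- have [u00|u00] := leP u 0.
    have -> : u = 0 by lra.
    by rewrite rt0; lra.
  have h1 x0 : 0 <= x0 -> x0 < u -> f u <= 1 - x0.
    move=> h0 hu; apply: rt_left_cont => // x xu.
    have [xx0|xx0] := leP x x0.
      have := @rt_homo _ _ rf x x0 ltac:(lra) ltac:(lra) ltac:(lra).
      by have := lu x0 h0 hu; lra.
    by have := lu x ltac:(lra) ltac:(lra); lra.
  rewrite leNgt; apply/negP => h.
  have fu1 : f u <= 1 by apply: (@le_trans _ _ u) => //; apply: rt_le_id => //; lra.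
  by have := h1 ((u + (1 - f u)) / 2) ltac:(lra) ltac:(lra); lra.
- rewrite leNgt; apply/negP => h.
  have fu0 : 0 <= f u by apply: rt_ge0 => //; lra.
  have f11 : f 1 <= 1 by apply: rt_le_id => //; lra.
  have u10 : 0 < 1 - u by lra.
  (* For [y] in [A], the chord inequality yields [(1 - u - f u) * (1 - u) <= 2 * (y - u)], so no
     point of [A] is this close to [u]. *)
  have e0 : 0 < (1 - u - f u) * (1 - u) / 2.
    by rewrite divr_gt0// mulr_gt0//; lra.
  have [y [y01 fy] yu] := inf_adherent e0 iA.
  rewrite -/u in yu.
  have uy : u <= y by apply: ge_inf; [exists 0|split].
  have := @rt_slope3 u y 1 u0 uy ltac:(lra) (lexx 1).
  nra.
Qed.

Lemma rt_iter01 k x : 0 <= x <= 1 -> 0 <= iter k f x <= x.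
Proof.
move=> x01; elim: k => [|k IH]; first by rewrite /=; lra.
rewrite iterS; have h : 0 <= iter k f x <= 1 by lra.
by have := rt_le_id rf h; have := rt_ge0 rf h; lra.
Qed.

(** For positive [c], the chord from the origin gives [f x <= r * x] on [[0, c]] with
    [r = f c / c < 1], so the iterates decay geometrically. *)
Lemma rt_iter_cvg0 c e : nontrivial_tradeoff f -> 0 <= c < 1 -> 0 < e ->
  exists k, iter k f c < e.
Proof.
move=> nt c01 e0.
have [c0|c0] := leP c 0; first by exists 0%N => /=; lra.
pose r := f c / c.
have fc : f c < c by apply: rt_lt_id => //; lra.
have fc0 : 0 <= f c by apply: rt_ge0 => //; lra.
have r0 : 0 <= r by rewrite divr_ge0// ltW.
have r1 : r < 1 by rewrite ltr_pdivrMr// mul1r.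
have ub k : iter k f c <= c * r ^+ k.
  elim: k => [|k IH]; first by rewrite /= expr0 mulr1.
  have h := @rt_iter01 k c ltac:(lra).
  have hs := @rt_star (iter k f c) c ltac:(lra) ltac:(lra) ltac:(lra).
  rewrite iterS -(ler_pM2r c0); apply: le_trans hs _.
  rewrite exprS {1}/r.
  have -> : c * (f c / c * r ^+ k) * c = f c * (c * r ^+ k) by field; lra.
  by rewrite ler_wpM2l.
have /cvgrPdist_lt/(_ _ e0)[N _ /(_ N (leqnn N))] :=
  @cvg_geometric R c r ltac:(by rewrite ger0_norm).
rewrite /= sub0r normrN => h; exists N.
by rewrite (le_lt_trans (ub N))// (le_lt_trans (ler_norm _)).
Qed.

End RegularTradeoffTheory.

(** * Tests and their expectations *)

Section Tests.
Context d (T : measurableType d) (R : realType).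
Implicit Types (P Q : probability T R) (phi : {mfun T >-> R}).

Definition is_test phi := forall t, 0 <= phi t <= 1.

Lemma test_integrable P phi : is_test phi ->
  P.-integrable [set: T] (EFin \o phi).
Proof.
move=> h; apply: measurable_bounded_integrable => //.
  by rewrite (le_lt_trans (probability_le1 P _)) ?ltry.
exists 1; split => // M M1 x _ /=.
have hx := h x; rewrite ger0_norm; [|lra]. lra.
Qed.

Lemma test_Lfun P phi : is_test phi -> (phi : T -> R) \in Lfun P 1.
Proof. by move=> h; apply/Lfun1_integrable; exact: test_integrable. Qed.

Lemma test_expectationE P phi : is_test phi ->
  'E_P[phi]%E = (fine 'E_P[phi])%:E.
Proof. by move=> h; rewrite fineK// expectation_fin_num// test_Lfun. Qed.

Lemma test_expectation01 P phi : is_test phi -> 0 <= fine 'E_P[phi] <= 1.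
Proof.
move=> h; rewrite -!lee_fin -test_expectationE//; apply/andP; split.
  by apply: expectation_ge0 => t; have /andP[] := h t.
rewrite -(expectation_cst P 1); apply: expectation_le => //.
- by move=> t; have /andP[] := h t.
- by apply: aeW => t; have /andP[] := h t.
Qed.

Lemma is_test_indic (A : set T) (mA : measurable A) : is_test (mindic R mA).
Proof.
move=> t; have -> : (mindic R mA : {mfun T >-> R}) t = \1_A t by [].
by rewrite indicE ler0n lern1 leq_b1.
Qed.

Definition test_compl phi : {mfun T >-> R} :=
  (cst 1 : {mfun T >-> R}) - phi.

Lemma is_test_compl phi : is_test phi -> is_test (test_compl phi).
Proof.
by move=> h t; rewrite -[test_compl phi t]/(1 - phi t); have := h t; lra.
Qed.

Lemma test_expectation_compl P phi : is_test phi ->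
  fine 'E_P[test_compl phi] = 1 - fine 'E_P[phi].
Proof.
move=> h; have -> : (test_compl phi : T -> R) = cst 1 \- phi by [].
have h1 : is_test (cst 1 : {mfun T >-> R}) by move=> t /=; lra.
rewrite (expectationB (test_Lfun P h1) (test_Lfun P h)).
by rewrite expectation_cst (test_expectationE P h).
Qed.

Definition test_mix (l : R) phi psi : {mfun T >-> R} :=
  (cst l : {mfun T >-> R}) * phi + (cst (1 - l) : {mfun T >-> R}) * psi.

Lemma is_test_mix l phi psi : 0 <= l <= 1 -> is_test phi -> is_test psi ->
  is_test (test_mix l phi psi).
Proof.
move=> l01 h h' t.
rewrite -[test_mix l phi psi t]/(l * phi t + (1 - l) * psi t).
by have := h t; have := h' t; nra.
Qed.

Lemma test_expectation_mix P l phi psi : is_test phi -> is_test psi ->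
  fine 'E_P[test_mix l phi psi] =
    l * fine 'E_P[phi] + (1 - l) * fine 'E_P[psi].
Proof.
move=> h h'.
have -> : (test_mix l phi psi : T -> R) = (l \o* phi) \+ ((1 - l) \o* psi).
  by apply/funext => t /=; rewrite /test_mix /= mulrC [X in _ + X]mulrC.
have L := test_Lfun P h; have L' := test_Lfun P h'.
rewrite expectationD; [|exact: Lfun_scale|exact: Lfun_scale].
rewrite (expectationZl _ L) (expectationZl _ L').
by rewrite (test_expectationE P h) (test_expectationE P h').
Qed.

Lemma test_expectation_cst P (l : R) :
  fine 'E_P[(cst l : {mfun T >-> R})] = l.
Proof. by rewrite expectation_cst. Qed.

End Tests.

(** * Properties of the tradeoff function of two probabilities *)

Section TradeoffTheory.
Context d (T : measurableType d) (R : realType).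
Variables (P Q : probability T R).
Implicit Types (phi : {mfun T >-> R}) (a b : R).

Let values a := [set b | exists phi : {mfun T >-> R},
    [/\ forall t, 0 <= phi t <= 1,
        ('E_P[phi] <= (1 - a)%:E)%E
      & b = 1 - fine 'E_Q[phi]] ].

Let values_lb a : lbound (values a) 0.
Proof.
by move=> _ [phi [h _ ->]]; have := test_expectation01 Q h; lra.
Qed.

Let values_neq0 a : 0 <= a <= 1 -> values a !=set0.
Proof.
move=> a01; exists (1 - fine 'E_Q[(cst 0 : {mfun T >-> R})]).
exists (cst 0); split => //; first by move=> t /=; lra.
by rewrite expectation_cst lee_fin; lra.
Qed.

Lemma tradeoff_le a phi : is_test phi -> fine 'E_P[phi] <= 1 - a ->
  tradeoff P Q a <= 1 - fine 'E_Q[phi].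
Proof.
move=> h Ea; apply: ge_inf; first by exists 0; exact: values_lb.
by exists phi; split => //; rewrite (test_expectationE P h) lee_fin.
Qed.

Lemma le_tradeoff a b : 0 <= a <= 1 ->
  (forall phi, is_test phi -> fine 'E_P[phi] <= 1 - a ->
     b <= 1 - fine 'E_Q[phi]) ->
  b <= tradeoff P Q a.
Proof.
move=> a01 H; apply: lb_le_inf; first exact: values_neq0.
move=> _ [phi [h Ea ->]]; apply: H => //.
by rewrite (test_expectationE P h) lee_fin in Ea.
Qed.

Lemma tradeoff_lt a b : 0 <= a <= 1 -> tradeoff P Q a < b ->
  exists phi,
    [/\ is_test phi, fine 'E_P[phi] <= 1 - a & 1 - fine 'E_Q[phi] < b].
Proof.
move=> a01 /inf_lt[|_ [phi [h Ea ->]] lb]; first exact: values_neq0.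
exists phi; split => //.
by rewrite (test_expectationE P h) lee_fin in Ea.
Qed.

Lemma tradeoff_ge0 a : 0 <= a <= 1 -> 0 <= tradeoff P Q a.
Proof.
move=> a01; apply: le_tradeoff => // phi h _.
by have := test_expectation01 Q h; lra.
Qed.

Lemma tradeoff_le_id a : 0 <= a <= 1 -> tradeoff P Q a <= a.
Proof.
move=> a01; have h : is_test (cst (1 - a) : {mfun T >-> R}).
  by move=> t /=; lra.
by have := @tradeoff_le a _ h; rewrite !test_expectation_cst subKr; apply.
Qed.

Lemma tradeoff_homo a b : 0 <= a -> a <= b -> b <= 1 ->
  tradeoff P Q a <= tradeoff P Q b.
Proof.
move=> a0 ab b1; apply: le_tradeoff => [|phi h Eb]; first lra.
by apply: tradeoff_le => //; lra.
Qed.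

Lemma tradeoff_convex a b l : 0 <= a <= 1 -> 0 <= b <= 1 -> 0 <= l <= 1 ->
  tradeoff P Q (l * a + (1 - l) * b) <=
    l * tradeoff P Q a + (1 - l) * tradeoff P Q b.
Proof.
move=> a01 b01 l01; apply/ler_addgt0Pr => e e0.
have [||phi [h Ea Qa]] := @tradeoff_lt a (tradeoff P Q a + e) => //; first lra.
have [||psi [h' Eb Qb]] := @tradeoff_lt b (tradeoff P Q b + e) => //; first lra.
have := @tradeoff_le (l * a + (1 - l) * b) _ (is_test_mix l01 h h').
rewrite !test_expectation_mix// => /(_ _)/le_trans; apply; nra.
Qed.

(* Near-optimal tests [phi n] of level [2^-n] are summable P-almost surely, so
   the event [A] that their sum diverges is a test of level 0; outside [A] they
   tend to 0, so that asymptotically all their power lies in [A]. *)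
Lemma tradeoff_left_cont1 b :
  (forall a, 0 <= a < 1 -> tradeoff P Q a <= b) -> tradeoff P Q 1 <= b.
Proof.
move=> H; apply/ler_addgt0Pr => e e0.
have ex n : exists phi : {mfun T >-> R}, [/\ is_test phi,
    fine 'E_P[phi] <= 1 / (2 ^ n.+1)%:R & 1 - fine 'E_Q[phi] < b + e].
  have p0 : (0 : R) < 1 / (2 ^ n.+1)%:R by rewrite divr_gt0// ltr0n expn_gt0.
  have p1 : (1 : R) / (2 ^ n.+1)%:R <= 1.
    by rewrite ler_pdivrMr ?mul1r ?ler1n ?ltr0n expn_gt0.
  have [||phi [h Ep Eq]] := @tradeoff_lt (1 - 1 / (2 ^ n.+1)%:R) (b + e).
  - lra.
  - have := H (1 - 1 / (2 ^ n.+1)%:R); lra.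
  by exists phi; rewrite subKr in Ep.
have {ex}[phi /all_and3[h Ep Eq]] := choice ex.
pose u n x := (phi n x)%:E.
have mu n : measurable_fun [set: T] (u n) by exact/measurable_EFinP.
have u0 n x : (0 <= u n x)%E by rewrite lee_fin; have /andP[] := h n x.
pose S x := (\sum_(n <oo) u n x)%E.
have mS : measurable_fun [set: T] S.
  by apply: ge0_emeasurable_sum.
have S0 x : (0 <= S x)%E by apply: nneseries_ge0.
pose A := S @^-1` [set +oo%E].
have mA : measurable A.
  by rewrite -[A]setTI; apply: mS => //; exact: emeasurable_set1.
have PA : P A = 0%E.
  have iS : P.-integrable [set: T] S.
    apply/integrableP; split => //.
    under eq_integral do rewrite gee0_abs//.
    rewrite integral_nneseries//.
    have /cvg_lim := @cvg_geometric_eseries_half R 1 0.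
    rewrite expr0 divr1 => E1.
    apply: (@le_lt_trans _ _ 1%E); last exact: ltry.
    rewrite -E1//; apply: lee_nneseries => [n _ _|n _].
      exact: integral_ge0.
    rewrite addn1; have := Ep n; rewrite -lee_fin -test_expectationE//.
    by rewrite unlock.
  apply: measure_negligible => //.
  apply: negligibleS (integrable_ae measurableT iS) => x /= Ax.
  by move=> /(_ I); rewrite Ax.
pose chi : {mfun T >-> R} := mindic R mA.
have hchi : is_test chi by exact: is_test_indic.
(* The test [chi] has level 0, so it remains to show [1 - Q A <= b + e]: each [phi n] has power
   above [1 - (b + e)], at most [Q A] of it on [A] and a vanishing part outside. *)
have := @tradeoff_le 1 chi hchi.
rewrite !expectation_indic// PA subrr lexx => /(_ isT)/le_trans; apply.
have cvI : (\int[Q]_(x in ~` A) u n x)%E @[n --> \oo] --> (0 : \bar R)%E.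
  rewrite -(@integral0 _ _ _ Q (~` A)).
  apply: (@dominated_cvg _ _ _ Q _ (measurableC mA) u (cst 0%E) (cst 1%E)) => //.
  - by move=> n; exact: measurable_funTS.
  - move=> x Ax /=.
    have Sx : (S x < +oo)%E by rewrite ltey; apply/eqP.
    apply: squeeze_cvge (cvg_cst _) (nneseries_tail_cvg Sx (fun k _ => u0 k x)).
    apply: nearW => n; rewrite u0 /=.
    apply: le_trans (@nneseries_lim_ge R (u ^~ x) xpredT n n.+1 (fun k _ _ => u0 k x)).
    by rewrite big_nat1.
  - exact: (@finite_measure_integrable_cst _ _ _ Q _ 1 (measurableC mA)).
  - by move=> n x _; rewrite gee0_abs// lee_fin; have /andP[] := h n x.
have low n : ((1 - (b + e) - fine (Q A))%:E <= \int[Q]_(x in ~` A) u n x)%E.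
  have QA : Q A = (fine (Q A))%:E by rewrite fineK// fin_num_measure.
  rewrite EFinB -QA leeBlDl ?fin_num_measure//.
  apply: (@le_trans _ _ 'E_Q[phi n]%E).
    by rewrite (test_expectationE Q (h n)) lee_fin; have := Eq n; lra.
  have -> : ('E_Q[phi n] = \int[Q]_(x in A) u n x + \int[Q]_(x in ~` A) u n x)%E.
    rewrite unlock -[in LHS](setUv A).
    apply: ge0_integral_setU => //.
    - exact: measurableC.
    - exact: measurable_funTS (mu n).
    - by move=> x _; exact: u0.
    - by rewrite disj_set2E setICr eqxx.
  apply: leeD => //.
  rewrite -[leRHS]mul1e -integral_cst//.
  apply: ge0_le_integral => //.
  - exact: measurable_funTS.
  - by move=> x _; rewrite lee_fin; have /andP[] := h n x.
have lim0 := cvg_lim (@ereal_hausdorff R) cvI.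
have : ((1 - (b + e) - fine (Q A))%:E <= 0)%E.
  rewrite -lim0; apply: lime_ge; last exact: nearW.
  by apply/cvg_ex; exists 0%E.
by rewrite lee_fin; lra.
Qed.
End TradeoffTheory.

Lemma symmetric_tradeoff_regular (R : realType) (f : R -> R) :
  is_tradeoff f -> symmetric_tradeoff f -> regular_tradeoff f.
Proof.
move=> [d [T [P [Q fPQ]]]] fs; have fQP := fs _ _ _ _ fPQ.
split.
- by move=> x x01; rewrite fPQ// tradeoff_ge0.
- by move=> x x01; rewrite fPQ// tradeoff_le_id.
- by move=> x y x0 xy y1; rewrite !fPQ; [exact: tradeoff_homo|lra|lra].
- move=> x y l x01 y01 l01; rewrite !fPQ//; [exact: tradeoff_convex|nra].
- move=> b h; rewrite fPQ; last lra.
  by apply: tradeoff_left_cont1 => a a01; rewrite -fPQ; [exact: h|lra].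
(* A test of [P] against [Q] with level [t] and type II error below [b] has as complement a test of
   [Q] against [P] with the two errors exchanged; symmetry identifies both tradeoff functions with
   [f]. *)
- move=> t b t01 b01; rewrite fPQ; last lra.
  move=> /tradeoff_lt[|phi [h]]; first lra.
  rewrite subKr => Et Eb; rewrite fQP; last lra.
  have := @tradeoff_le _ _ _ Q P (1 - b) _ (is_test_compl h).
  by rewrite !test_expectation_compl// subKr => /(_ _)/le_trans; apply; lra.
Qed.

(** * Integer-valued random variables *)

(** The order 0, -1, 1, -2, 2, ..., whose first [2m + 1] terms are the integers from [-m] to [m]. *)
Definition int_enum (n : nat) : int := if odd n then Negz n./2 else Posz n./2.
Definition int_code (k : int) : nat :=
  match k with Posz m => m.*2 | Negz m => m.*2.+1 end.

Lemma int_codeK : cancel int_code int_enum.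
Proof.
case=> m; rewrite /int_enum /int_code /=; first by rewrite odd_double doubleK.
by rewrite odd_double /= uphalf_double.
Qed.

Lemma int_enumK : cancel int_enum int_code.
Proof.
move=> n; rewrite /int_enum.
by case: ifP => o /=; have := odd_double_half n; rewrite o.
Qed.

Section IntValued.
Context d (T : measurableType d) (R : realType) (P : probability T R).
Implicit Types (N M : {RV P >-> R}).

Definition int_valued N : Prop := {ae P, forall w, N w \is a Num.int}.

Lemma measure_ae_eq (A B : set T) : measurable A -> measurable B ->
  {ae P, forall w, A w <-> B w} -> P A = P B.
Proof.
move=> mA mB AB; rewrite -(setIT A) -(setIT B).
rewrite -!integral_indic//; apply: ae_eq_integral => //;
  try by apply/measurable_EFinP; exact: measurable_indic.
apply: filterS AB => w AB _; rewrite !indicE.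
by have -> : (w \in A) = (w \in B) by apply/idP/idP; rewrite !inE => /AB.
Qed.

Lemma probability_fineK (A : set T) : measurable A -> (fine (P A))%:E = P A.
Proof. by move=> mA; rewrite fineK// fin_num_measure. Qed.

Lemma pmfK N x : (pmf N x)%:E = P (N @^-1` [set x]).
Proof. by apply: probability_fineK; exact: measurable_funPTI. Qed.

Lemma int_valued_integral N (phi : R -> R) :
  int_valued N -> measurable_fun [set: R] phi -> (forall x, 0 <= phi x) ->
  (\int[P]_w (phi (N w))%:E =
   \sum_(n <oo) (phi (int_enum n)%:~R * pmf N (int_enum n)%:~R)%:E)%E.
Proof.
move=> hN mphi phi0.
pose F n := N @^-1` [set (int_enum n)%:~R].
have mF n : measurable (F n) by exact: measurable_funPTI.
have mU : measurable (\bigcup_n F n) by exact: bigcup_measurable.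
have U0 : P (~` \bigcup_n F n) = 0%E.
  apply: measure_negligible; first exact: measurableC.
  apply: negligibleS hN => w nU /= /intrP[k Nk]; apply: nU.
  by exists (int_code k) => //; rewrite /F /= int_codeK.
have mphiN : measurable_fun [set: T] (fun w => (phi (N w))%:E).
  by apply/measurable_EFinP; exact: measurableT_comp.
have tF : trivIset [set: nat] F.
  apply/trivIsetP => i j _ _ ij; apply/seteqP; split => // w [/= Fi Fj].
  move: ij => /eqP; apply; apply: (can_inj int_enumK).
  by apply/eqP; rewrite -(eqr_int R) -Fi -Fj.
rewrite (@ge0_negligible_integral _ _ _ P _ _ _
  (measurableC mU) measurableT mphiN)//; last by move=> w _; rewrite lee_fin.
rewrite setTD setCK ge0_integral_bigcup//; last 2 first.
- exact: measurable_funTS.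
- by move=> w _; rewrite lee_fin.
apply: eq_eseriesr => n _.
rewrite EFinM pmfK -/(F n) -integral_cst//.
by apply: eq_integral => w; rewrite inE => ->.
Qed.

Lemma test_distribution N (phi : {mfun R >-> R}) : is_test phi ->
  ('E_(distribution P N)[phi] = \int[P]_w (phi (N w))%:E)%E.
Proof.
move=> h; rewrite unlock ge0_integral_distribution//.
  by apply/measurable_EFinP.
by move=> y; rewrite lee_fin; have /andP[] := h y.
Qed.

Lemma test_distributionE N (phi : {mfun R >-> R}) : is_test phi ->
  (fine 'E_(distribution P N)[phi])%:E = (\int[P]_w (phi (N w))%:E)%E.
Proof. by move=> h; rewrite -test_expectationE// test_distribution. Qed.

(** The Neyman-Pearson comparison with likelihood ratio threshold [s]: the hypothesis is
    [(phi - chi) * (pmf M - s * pmf N) <= 0] at each integer. Terms are moved across so that only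
    nonnegative series are summed. *)
Lemma test_distribution_lin_le N M (phi chi : {mfun R >-> R}) (s : R) :
  int_valued N -> int_valued M -> is_test phi -> is_test chi -> 0 <= s ->
  (forall k : int,
    phi k%:~R * pmf M k%:~R + s * (chi k%:~R * pmf N k%:~R) <=
    s * (phi k%:~R * pmf N k%:~R) + chi k%:~R * pmf M k%:~R) ->
  fine 'E_(distribution P M)[phi] + s * fine 'E_(distribution P N)[chi] <=
  s * fine 'E_(distribution P N)[phi] + fine 'E_(distribution P M)[chi].
Proof.
move=> hN hM hphi hchi s0 H.
have p0 x : 0 <= phi x by have /andP[] := hphi x.
have c0 x : 0 <= chi x by have /andP[] := hchi x.
rewrite -lee_fin !EFinD !EFinM !test_distributionE//.
rewrite !int_valued_integral//.
have q0 (g : {mfun R >-> R}) L n : (forall x, 0 <= g x) ->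
    (0 <= (g (int_enum n)%:~R * pmf L (int_enum n)%:~R)%:E)%E.
  by move=> g0; rewrite lee_fin mulr_ge0// pmf_ge0.
have sq0 (g : {mfun R >-> R}) L n : (forall x, 0 <= g x) ->
    (0 <= s%:E * (g (int_enum n)%:~R * pmf L (int_enum n)%:~R)%:E)%E.
  by move=> g0; apply: mule_ge0; [rewrite lee_fin|exact: q0].
rewrite -!nneseriesZl; try by move=> n _; exact: q0.
rewrite -!nneseriesD; try by move=> n _ _; (exact: q0 || exact: sq0).
apply: lee_nneseries => [n _ _|n _]; last first.
  by rewrite -!EFinM -!EFinD lee_fin.
by apply: adde_ge0; [exact: q0|exact: sq0].
Qed.

Lemma rcdfK N x : (rcdf N x)%:E = P [set w | N w <= x].
Proof.
have -> : [set w | N w <= x] = N @^-1` `]-oo, x].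
  by apply/seteqP; split => w /=; rewrite in_itv.
by rewrite -probability_fineK//; exact: measurable_funPTI.
Qed.

Lemma measurable_le_set N x : measurable [set w | N w <= x].
Proof.
have -> : [set w | N w <= x] = N @^-1` `]-oo, x].
  by apply/seteqP; split => w /=; rewrite in_itv.
exact: measurable_funPTI.
Qed.

Lemma rcdf01 N x : 0 <= rcdf N x <= 1.
Proof.
rewrite -!lee_fin rcdfK measure_ge0 probability_le1//.
exact: measurable_le_set.
Qed.

Lemma rcdf_homo N : {homo rcdf N : x y / x <= y}.
Proof.
move=> x y xy; rewrite -lee_fin !rcdfK le_measure ?inE//;
  try exact: measurable_le_set.
by move=> w /= /le_trans; apply.
Qed.

Lemma rcdf_lt N e : 0 < e -> exists k : int, rcdf N k%:~R < e.
Proof.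
move=> e0; have h : rcdf N x @[x --> -oo] --> (0 : R).
  by apply: fine_cvg; exact: cvg_cdfNy0.
have [M [_ HM]] := cvgr_lt _ h _ e0.
exists (Num.floor M - 1); apply: HM.
by rewrite (lt_le_trans _ (floor_le M))// ltr_int ltrBlDr ltrDl.
Qed.

Lemma rcdf_gt N e : e < 1 -> exists k : int, e < rcdf N k%:~R.
Proof.
move=> e0; have h : rcdf N x @[x --> +oo] --> (1 : R).
  by apply: fine_cvg; exact: cvg_cdfy1.
have [M [_ HM]] := cvgr_gt _ h _ e0.
exists (Num.floor M + 1); apply: HM.
exact: floorD1_gt.
Qed.

Lemma expectation_gt N x (chi : {mfun R >-> R}) :
  (chi : R -> R) = \1_`]x, +oo[%classic ->
  fine 'E_(distribution P N)[chi] = 1 - rcdf N x.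
Proof.
move=> ->; rewrite expectation_indic//.
have -> : `]x, +oo[%classic = ~` `]-oo, x]%classic :> set R by rewrite setCitvl.
by rewrite probability_setC// fineB// fin_num_measure.
Qed.

End IntValued.

Section IntValuedCdf.
Context d (T : measurableType d) (R : realType) (P : probability T R).
Implicit Types (N : {RV P >-> R}).

Lemma int_valued_shift N (t : int) :
  int_valued N -> int_valued (rv_shift N t%:~R).
Proof.
by apply: filterS => w Nw; rewrite -[rv_shift _ _ _]/(N w + t%:~R) rpredD// intr_int.
Qed.

Lemma int_valued_opp N : int_valued N -> int_valued (rv_opp N).
Proof. by apply: filterS => w Nw; rewrite -[rv_opp _ _]/(- N w) rpredN. Qed.

Lemma pmf_shift N m x : pmf (rv_shift N m) x = pmf N (x - m).
Proof.
congr (fine (P _)); apply/seteqP; split => w e.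
  by have <- : N w + m = x := e; rewrite /preimage /= addrK.
by change (N w + m = x); rewrite [N w]e subrK.
Qed.

Lemma pmf_opp N x : pmf (rv_opp N) x = pmf N (- x).
Proof.
congr (fine (P _)); apply/seteqP; split => w e.
  by have <- : - N w = x := e; rewrite /preimage /= opprK.
by change (- N w = x); rewrite [N w]e opprK.
Qed.

Lemma rcdf_shift N m x : rcdf (rv_shift N m) x = rcdf N (x - m).
Proof.
apply: EFin_inj; rewrite !rcdfK; congr (P _); apply/seteqP.
by split => w e; [have {}e : N w + m <= x := e; change (is_true (N w <= x - m))
  |have {}e : N w <= x - m := e; change (is_true (N w + m <= x))]; lra.
Qed.

Lemma int_valued_pmf N (t : int) : int_valued N ->
  pmf N t%:~R = rcdf N t%:~R - rcdf N (t - 1)%:~R.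
Proof.
move=> hN; apply: EFin_inj; rewrite EFinB pmfK !rcdfK.
pose A := [set w | N w <= (t - 1)%:~R].
pose B := N @^-1` [set t%:~R].
have mA : measurable A by exact: measurable_le_set.
have mB : measurable B by exact: measurable_funPTI.
have -> : P [set w | N w <= t%:~R] = P (A `|` B).
  apply: measure_ae_eq; [exact: measurable_le_set|exact: measurableU|].
  apply: filterS hN => w /intrP[k]; rewrite /A /B /= => ->; split.
    rewrite !ler_int => kt; have [->|nkt] := eqVneq k t; first by right.
    by left; lia.
  by rewrite !ler_int => -[|/eqP]; [|rewrite eqr_int => /eqP]; lia.
rewrite measureU//; last first.
  apply/seteqP; split => // w; rewrite /A /B /= => -[] + e.
  by rewrite e ler_int; lia.
by rewrite addeAC subee ?add0e// fin_num_measure.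
Qed.

Lemma int_valued_rcdf_opp N (t : int) : int_valued N ->
  rcdf (rv_opp N) t%:~R = 1 - rcdf N (- t - 1)%:~R.
Proof.
move=> hN; apply: EFin_inj; rewrite EFinB !rcdfK.
rewrite -probability_setC; last exact: measurable_le_set.
apply: measure_ae_eq; [exact: measurable_le_set| |].
  by apply: measurableC; exact: measurable_le_set.
apply: filterS hN => w /intrP[k] e.
change (- N w <= t%:~R <-> ~ (N w <= (- t - 1)%:~R)).
by rewrite e -intrN !ler_int; split => [h|/negP]; [apply/negP|]; lia.
Qed.

Lemma int_valued_distribution N (A : set R) : int_valued N -> measurable A ->
  (distribution P N A = \sum_(n <oo)
    (\1_A (int_enum n)%:~R * pmf N (int_enum n)%:~R)%:E)%E.
Proof.
move=> hN mA; rewrite -int_valued_integral//.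
have mNA : measurable (N @^-1` A) by exact: measurable_funPTI.
rewrite -[LHS]/(P (N @^-1` A)) -(setIT (N @^-1` A)) -integral_indic//.
Qed.

End IntValuedCdf.

Lemma int_valued_same_distribution (R : realType)
    d (T : measurableType d) (P : probability T R) (N : {RV P >-> R})
    d' (T' : measurableType d') (P' : probability T' R) (N' : {RV P' >-> R}) :
  int_valued N -> int_valued N' ->
  (forall k : int, pmf N k%:~R = pmf N' k%:~R) -> same_distribution N N'.
Proof.
move=> hN hN' e A mA; rewrite !int_valued_distribution//.
by apply: eq_eseriesr => n _; rewrite e.
Qed.

(** * Symmetric integer-valued variables and reflected tests *)

Section Symmetry.
Context d (T : measurableType d) (R : realType) (P : probability T R).
Implicit Types (N : {RV P >-> R}).

Lemma same_distribution_rcdf d' (T' : measurableType d') (P' : probability T' R)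
    N (N' : {RV P' >-> R}) x : same_distribution N N' -> rcdf N x = rcdf N' x.
Proof. by move=> h; rewrite /rcdf /cdf h. Qed.

Lemma int_valued_symmetric_rcdf N (t : int) : int_valued N ->
  same_distribution N (rv_opp N) -> rcdf N t%:~R = 1 - rcdf N (- t - 1)%:~R.
Proof.
by move=> hN sN; rewrite (same_distribution_rcdf _ sN) int_valued_rcdf_opp.
Qed.

Lemma rcdf_int_valued_symmetric N : int_valued N ->
  (forall t : int, rcdf N t%:~R = 1 - rcdf N (- t - 1)%:~R) ->
  same_distribution N (rv_opp N).
Proof.
move=> hN sN; apply: int_valued_same_distribution => //.
  exact: int_valued_opp.
move=> k; rewrite pmf_opp -intrN !int_valued_pmf// sN (sN (k - 1)).
have -> : - (k - 1) - 1 = - k by lia.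
by lra.
Qed.

Lemma symmetric_integral N (g : R -> R) : same_distribution N (rv_opp N) ->
  measurable_fun [set: R] g -> (forall x, 0 <= g x) ->
  (\int[P]_w (g (N w))%:E = \int[P]_w (g (- N w))%:E)%E.
Proof.
move=> sN mg g0.
have mG : measurable_fun [set: R] (EFin \o g) by exact/measurable_EFinP.
have G0 y : (0 <= (EFin \o g) y)%E by rewrite lee_fin.
transitivity (\int[distribution P N]_y (g y)%:E)%E.
  by rewrite ge0_integral_distribution.
rewrite (@eq_measure_integral _ _ _ setT (distribution P (rv_opp N))).
  by rewrite ge0_integral_distribution.
by move=> A mA _; exact: sN.
Qed.

(** Reflecting a test of [N] against [N - m] gives a test of [N] against [N + m] with the same
    errors, because [- (N + m)] has the law of [N - m]. *)
Lemma symmetric_tradeoff_shift N m a : same_distribution N (rv_opp N) ->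
  0 <= a <= 1 ->
  rv_tradeoff N (rv_shift N m) a <= rv_tradeoff N (rv_shift N (- m)) a.
Proof.
move=> sN a01; apply: le_tradeoff => // phi h Ea.
have mpsi : measurable_fun [set: R] (fun x => phi (- x)).
  by apply: measurableT_comp => //; exact: oppr_measurable.
pose psi : {mfun R >-> R} := mfun_Sub (mem_set mpsi).
have hpsi : is_test psi by move=> x; exact: h.
have phi0 x : 0 <= phi x by have /andP[] := h x.
have e1 : fine 'E_(distribution P N)[psi] = fine 'E_(distribution P N)[phi].
  apply: EFin_inj; rewrite !test_distributionE//.
  by rewrite [RHS]symmetric_integral.
have e2 : fine 'E_(distribution P (rv_shift N m))[psi] =
          fine 'E_(distribution P (rv_shift N (- m)))[phi].
  apply: EFin_inj; rewrite !test_distributionE//.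
  rewrite [RHS](@symmetric_integral N (fun x => phi (x - m)))//.
    by apply: eq_integral => w _; congr (phi _)%:E; rewrite -[LHS]/(- (N w + m)) opprD.
  apply: measurableT_comp => //; exact: measurable_funB.
by rewrite -e2; apply: tradeoff_le => //; rewrite e1.
Qed.

End Symmetry.

(** * The Neyman-Pearson bound for a shift by 1 *)

Section NeymanPearson.
Context d (T : measurableType d) (R : realType) (P : probability T R).
Variables (f : R -> R) (N : {RV P >-> R}).
Hypotheses (rf : regular_tradeoff f) (hN : int_valued N).
Let F (t : int) := rcdf N t%:~R.
(** Where [F (t + 1) = 1] the recurrence may fail, for [f 1] can be below 1 while [F t = 1]; the
    inequality survives there. *)
Hypotheses (F_le : forall t : int, f (F (t + 1)) <= F t)
  (F_eq : forall t : int, F (t + 1) < 1 -> f (F (t + 1)) = F t).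

Let F01 t : 0 <= F t <= 1. Proof. exact: rcdf01. Qed.
Let F_homo s t : s <= t -> F s <= F t.
Proof. by move=> st; apply: rcdf_homo; rewrite ler_int. Qed.
Let p t := F t - F (t - 1).
Let p0 t : 0 <= p t. Proof. by rewrite subr_ge0 F_homo// lerBlDr lerDl. Qed.
Let F_le1 t : f (F t) <= F (t - 1).
Proof. by have := F_le (t - 1); rewrite subrK. Qed.
Let F_eq1 t : F t < 1 -> f (F t) = F (t - 1).
Proof. by have := @F_eq (t - 1); rewrite subrK. Qed.

Let quantile_int a : 0 < a < 1 -> exists x, F (x - 1) < a /\ a <= F x.
Proof.
move=> /andP[a0 a1].
have [l hl] := rcdf_lt N a0; have [u hu] := rcdf_gt N a1.
have ex : exists n : nat, a <= F (l + n%:Z).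
  exists `|u - l|%N; apply/ltW/(lt_le_trans hu)/F_homo; lia.
have := ex_minnP ex; case=> -[|m] hm mm.
  by rewrite addr0 leNgt hl in hm.
exists (l + m.+1%:Z); split => //.
rewrite ltNge; apply/negP => h.
have : a <= F (l + m%:Z) by have -> : l + m%:Z = l + m.+1%:Z - 1 by lia.
by move/mm; rewrite ltnn.
Qed.

(* The likelihood ratio [p (k - 1) / p k] is a slope of the convex function
   [f], hence nondecreasing in [k]. *)
Let ratio_mono x k : F (x - 1) < F x ->
  if x < k then p (x - 1) * p k <= p (k - 1) * p x
  else p (k - 1) * p x <= p (x - 1) * p k.
Proof.
move=> Fx; case: ltP => [xk|kx].
- have [Fk|Fk] := ltP (F (k - 1)) 1; last first.
    have -> : p k = 0.
      by have := F01 k; have := p0 k; rewrite /p; lra.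
    by rewrite mulr0 mulr_ge0.
  have Fx1 : F x < 1 by rewrite (le_lt_trans _ Fk)// F_homo; lia.
  have := @rt_slope4 _ _ rf (F (x - 1)) (F x) (F (k - 1)) (F k).
  rewrite (F_eq1 Fk) (F_eq1 Fx1) (@F_eq1 (x - 1)); last by lra.
  have Fxk : F x <= F (k - 1) by apply: F_homo; lia.
  have Fkk : F (k - 1) <= F k by apply: F_homo; lia.
  have /andP[Fx0 _] := F01 (x - 1); have /andP[_ Fk1] := F01 k.
  move=> /(_ Fx0 (ltW Fx) Fxk Fkk Fk1).
  have := F_le1 k; have := p0 x; rewrite /p; nra.
- have [->//|nkx] := eqVneq k x.
  have {nkx kx} kx : k <= x - 1 by lia.
  have Fx1 : F (x - 1) < 1 by have := F01 x; lra.
  have Fk : F k <= F (x - 1) by exact: F_homo.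
  have Fkk : F (k - 1) <= F k by apply: F_homo; lia.
  have := @rt_slope4 _ _ rf (F (k - 1)) (F k) (F (x - 1)) (F x).
  rewrite (F_eq1 Fx1) (@F_eq1 k) ?(@F_eq1 (k - 1)); try lra.
  have /andP[Fk0 _] := F01 (k - 1); have /andP[_ FX1] := F01 x.
  move=> /(_ Fk0 Fkk Fk (ltW Fx) FX1).
  have := F_le1 x; have := p0 k; rewrite /p; nra.
Qed.

(** Let [x] be the integer quantile of [a]. Comparing a test with the ray beyond [x], at the
    likelihood ratio [s] of [x], bounds its type II error below by [F (x - 1) - s * (F x - a)]. This
    is the value at [a] of the chord through [(F (x - 1), F (x - 2))] and [(F x, F (x - 1))], and
    [f] lies below that chord by convexity. *)
Let shift_tradeoff_in a : 0 < a < 1 -> f a <= rv_tradeoff N (rv_shift N 1) a.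
Proof.
move=> a01; apply: le_tradeoff => [|phi h Ea]; first lra.
have [x [Fx1 Fx]] := quantile_int a01.
have Fxx : F (x - 1) < F x := lt_le_trans Fx1 Fx.
have px : 0 < p x by rewrite subr_gt0.
pose s := p (x - 1) / p x.
have s0 : 0 <= s by rewrite divr_ge0.
pose chi : {mfun R >-> R} := mindic R (measurable_itv `]x%:~R, +oo[).
have hchi : is_test chi by exact: is_test_indic.
have sp k : s * p k * p x = p (x - 1) * p k by rewrite /s; field; lra.
have := @test_distribution_lin_le _ _ _ _ N (rv_shift N 1) phi chi s hN
  (int_valued_shift 1 hN) h hchi s0.
rewrite !(@expectation_gt _ _ _ _ _ x%:~R chi)// rcdf_shift.
have -> : x%:~R - 1 = (x - 1)%:~R :> R by rewrite intrB.
rewrite -/(F x) -/(F (x - 1)) => /(_ _) main.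
have {}main : fine 'E_(distribution P (rv_shift N 1))[phi] + s * (1 - F x) <=
    s * fine 'E_(distribution P N)[phi] + (1 - F (x - 1)).
  apply: main => k; rewrite pmf_shift.
  have -> : k%:~R - 1 = (k - 1)%:~R :> R by rewrite intrB.
  rewrite !int_valued_pmf// -/(F k) -/(F (k - 1)) -/(p k).
  rewrite -/(F (k - 1 - 1)) -/(p (k - 1)).
  rewrite -[chi _]/(\1_`]x%:~R, +oo[%classic _).
  rewrite indicE mem_setE in_itv /= andbT ltr_int.
  have := h k%:~R; move: (phi _) => y y01.
  have := ratio_mono k Fxx; rewrite -sp.
  (* [chi] is 1 beyond [x] and 0 elsewhere, and [ratio_mono] gives the sign of [p (k - 1) - s * p k]
     on each side. *)
  case: ltP => _; rewrite ler_pM2r// -subr_ge0 => hk.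
    rewrite -[true%:R]/(1 : R).
    by have : 0 <= (1 - y) * (p (k - 1) - s * p k); [rewrite mulr_ge0//; lra|lra].
  rewrite -[false%:R]/(0 : R).
  by have : 0 <= y * (s * p k - p (k - 1)); [rewrite mulr_ge0//; lra|lra].
have Fx2 : F (x - 1) <= F x by lra.
have := @rt_slope3 _ _ rf (F (x - 1)) a (F x); move: (F01 (x - 1)) (F01 x) => h1 h2.
move=> /(_ _ _ _ _) sl.
have {}sl := sl ltac:(lra) ltac:(lra) ltac:(lra) ltac:(lra).
have Fx11 : F (x - 1) < 1 by lra.
rewrite (F_eq1 Fx11) in sl.
have fx := F_le1 x.
have spx : s * p x = p (x - 1) by rewrite /s; field; lra.
have chord : f a * p x <= (F (x - 1) - s * (F x - a)) * p x.
  rewrite mulrBl mulrAC spx; rewrite /p in sl *; nra.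
rewrite ler_pM2r// in chord.
have : s * fine 'E_(distribution P N)[phi] <= s * (1 - a) by rewrite ler_wpM2l.
lra.
Qed.

Lemma le_shift_tradeoff a : 0 <= a <= 1 ->
  f a <= rv_tradeoff N (rv_shift N 1) a.
Proof.
have zero : f 0 <= rv_tradeoff N (rv_shift N 1) 0.
  by rewrite (rt0 rf) tradeoff_ge0//; lra.
move=> /andP[]; rewrite le_eqVlt => /orP[/eqP <- //|a0].
rewrite le_eqVlt => /orP[/eqP ->|a1]; last by apply: shift_tradeoff_in; lra.
(* The endpoint 1 is reached by left continuity of [f] and monotonicity of the tradeoff function. *)
apply: (rt_left_cont1 rf) => x /andP[]; rewrite le_eqVlt => /orP[/eqP <- _|x0 x1].
  by apply: le_trans zero _; apply: tradeoff_homo; lra.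
apply: le_trans (shift_tradeoff_in _) _; first lra.
by apply: tradeoff_homo; lra.
Qed.

End NeymanPearson.

(** * Canonical noise distributions *)

(** The indicator of the ray beyond [x] has level [1 - F x] and type II error [F (x - 1)], with [F]
    the cdf of [N]. *)
Lemma ray_tradeoff (R : realType) (f : R -> R) d (T : measurableType d)
    (P : probability T R) (N : {RV P >-> R}) (x : R) :
  (forall a, 0 <= a <= 1 -> f a <= rv_tradeoff N (rv_shift N 1) a) ->
  f (rcdf N x) <= rcdf N (x - 1).
Proof.
move=> /(_ _ (rcdf01 N x))/le_trans; apply.
pose chi : {mfun R >-> R} := mindic R (measurable_itv `]x, +oo[).
have hchi : is_test chi by exact: is_test_indic.
have := @tradeoff_le _ _ _ (distribution P N) (distribution P (rv_shift N 1))
  (rcdf N x) chi hchi.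
rewrite !(@expectation_gt _ _ _ _ _ x chi)// rcdf_shift.
by rewrite subKr; apply.
Qed.

(** * Discrete CNDs at sensitivity 1 *)

Section DiscreteCND.
Variables (R : realType) (f : R -> R).
Hypothesis rf : regular_tradeoff f.
Context d (T : measurableType d) (P : probability T R) (N : {RV P >-> R}).
Let F (t : int) := rcdf N t%:~R.

Lemma discrete_CND_intro :
  int_valued N ->
  (forall t, F t = 1 - F (- t - 1)) ->
  (forall t, f (F (t + 1)) <= F t) ->
  (forall t, F (t + 1) < 1 -> f (F (t + 1)) = F t) ->
  is_discrete_CND f 1 N.
Proof.
move=> hN sN F_le F_eq.
have dN := rcdf_int_valued_symmetric hN sN.
have pos a : 0 <= a <= 1 -> f a <= rv_tradeoff N (rv_shift N 1) a.
  exact: le_shift_tradeoff.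
split => // t t1 a a01.
have [|[|]] : t = 1 \/ t = 0 \/ t = -1 by lia.
- by move=> ->; exact: pos.
- move=> ->; apply: (le_trans (rt_le_id rf a01)).
  apply: le_tradeoff => // phi h.
  have -> : fine 'E_(distribution P (rv_shift N 0%:~R))[phi] =
            fine 'E_(distribution P N)[phi].
    apply: EFin_inj; rewrite !test_distributionE//.
    by apply: eq_integral => w _; rewrite -[rv_shift _ _ w]/(N w + 0) addr0.
  lra.
- move=> ->; apply: (le_trans (pos _ a01)).
  exact: (symmetric_tradeoff_shift 1 dN a01).
Qed.

Hypothesis dN : is_discrete_CND f 1 N.

Let hN : int_valued N. Proof. by case: dN. Qed.
Let sN t : F t = 1 - F (- t - 1).
Proof. by case: dN => _ _ _ s; exact: int_valued_symmetric_rcdf. Qed.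
Let F_le t : f (F (t + 1)) <= F t.
Proof.
have e : (t + 1)%:~R - 1 = t%:~R :> R by rewrite intrD addrK.
rewrite {2}/F -e; apply: ray_tradeoff => a a01.
by case: dN => /(_ 1 isT a a01).
Qed.
Let F_eq t : F (t + 1) < 1 -> f (F (t + 1)) = F t.
Proof. by case: dN => _ + _ _; apply. Qed.

Lemma discrete_CND_c_of : c_of f = F (-1) /\ f (1 - F (-1)) = F (-1).
Proof.
have F01 t : 0 <= F t <= 1 by exact: rcdf01.
have fc : f (1 - F (-1)) = F (-1).
  have <- : F 0 = 1 - F (-1) by rewrite sN oppr0 sub0r.
  have [F1|F1] := ltP (F 0) 1; first exact: (@F_eq (-1)).
  (* If [F 0 = 1] the recurrence gives nothing at 0, but then [F (-1) = 0] and [F_le] forces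
     [f (F 0) = 0]. *)
  have F0 : F 0 = 1 - F (-1) by rewrite sN oppr0 sub0r.
  apply/le_anti; rewrite (@F_le (-1))/=.
  by have := rt_ge0 rf (F01 0); have := F01 (-1); lra.
by split => //; rewrite (rt_c_of rf (F01 (-1)) fc).
Qed.

Lemma discrete_CND_rcdf (k : nat) : F (- k%:Z) = iter k f (1 - c_of f).
Proof.
have F0 : F 0 = 1 - F (-1) by rewrite sN oppr0 sub0r.
have Fm : F (-1) <= F 0 by apply: rcdf_homo; rewrite ler_int.
have [-> fc] := discrete_CND_c_of; rewrite -F0 in fc *.
elim: k => [|k IH]; first by rewrite oppr0.
rewrite iterS -IH.
have -> : - k.+1%:Z = - k%:Z - 1 by lia.
(* The step from 0 to -1 is the fixed-point equation, as [F 0] may be 1. Further left, [F] is at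
   most [F (-1) <= 1/2], so the recurrence applies. *)
case: k {IH} => [|k]; first by rewrite oppr0 sub0r fc.
have := @F_eq (- k.+1%:Z - 1); rewrite subrK => -> //.
have : F (- k.+1%:Z) <= F (-1) by apply: rcdf_homo; rewrite ler_int; lia.
lra.
Qed.

(** Since [c_of f = f (1 - c_of f)], the second iterate is the first taken one step further, and the
    difference is the jump of [F] at [- |k|]. *)
Lemma discrete_CND_pmf (k : int) : pmf N k%:~R =
  iter `|k|%N f (1 - c_of f) - iter `|k|%N f (c_of f).
Proof.
have [cE fc] := discrete_CND_c_of; rewrite -cE in fc.
rewrite -{2}fc -iterSr -!discrete_CND_rcdf.
rewrite int_valued_pmf// -/(F k) -/(F (k - 1)).
case: k => m /=.
  rewrite (sN m) (sN (m%:Z - 1)).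
  have -> : - (m%:Z - 1) - 1 = - m%:Z by lia.
  have -> : - m%:Z - 1 = - m.+1%:Z by lia.
  lra.
by congr (F _ - F _); lia.
Qed.

End DiscreteCND.

(** * Continuous CNDs and rounding *)

Section ContinuousCND.
Variables (R : realType) (f : R -> R).
Hypothesis rf : regular_tradeoff f.
Context d (T : measurableType d) (P : probability T R) (N : {RV P >-> R}).
Let F := rcdf N.

Lemma continuous_quantile a : continuous F -> 0 < a < 1 ->
  F (quantile F a) = a /\ forall y, a <= F y -> quantile F a <= y.
Proof.
move=> cF /andP[a0 a1]; pose S := [set x | a <= F x].
have [l hl] := rcdf_lt N a0; have [u hu] := rcdf_gt N a1.
have lbS : lbound S l%:~R.
  move=> x ax; rewrite leNgt; apply/negP => xl.
  by have := rcdf_homo N (ltW xl); rewrite leNgt (lt_le_trans hl).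
have S0 : S !=set0 by exists u%:~R; exact: ltW.
have low y : a <= F y -> quantile F a <= y.
  by move=> ay; apply: ge_inf => //; exists l%:~R.
split => //; set q := quantile F a.
apply/le_anti/andP; split; rewrite leNgt; apply/negP => h.
- have [e /= e0 he] := cvgr_gt _ (cF q) _ h.
  have : a < F (q - e / 2).
    apply: he; rewrite /ball /= opprB addrC subrK ger0_norm ?divr_ge0 ?ltW//.
    by rewrite ltr_pdivrMr// ltr_pMr// ltr1n.
  by move/ltW/low; rewrite -/q; lra.
- have [e /= e0 he] := cvgr_lt _ (cF q) _ h.
  have [y Sy yq] := inf_adherent e0 (conj S0 (ex_intro _ _ lbS)).
  rewrite -/(quantile F a) -/q in yq.
  have qy : q <= y by apply: low.
  have : F y < a by apply: he; rewrite /ball /= distrC ger0_norm; lra.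
  by rewrite ltNge Sy.
Qed.

(** There is no atom at [x]. The strict event matters because [round y <= t] means [y < t + 1/2]. *)
Lemma continuous_rcdf_lt x : continuous F ->
  P [set w | N w < x] = (F x)%:E.
Proof.
move=> cF.
have mlt : measurable [set w | N w < x].
  have -> : [set w | N w < x] = N @^-1` `]-oo, x[.
    by apply/seteqP; split => w /=; rewrite in_itv.
  exact: measurable_funPTI.
have mle y : measurable [set w | N w <= y] by exact: measurable_le_set.
apply/le_anti/andP; split.
  by rewrite /F rcdfK le_measure ?inE// => w /=; exact: ltW.
rewrite -probability_fineK// lee_fin leNgt; apply/negP => h.
have [e /= e0 he] := cvgr_gt _ (cF x) _ h.
have : fine (P [set w | N w < x]) < F (x - e / 2).
  apply: he; rewrite /ball /= opprB addrC subrK ger0_norm ?divr_ge0 ?ltW//.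
  by rewrite ltr_pdivrMr// ltr_pMr// ltr1n.
rewrite ltNge => /negP; apply.
rewrite /F -lee_fin rcdfK probability_fineK// le_measure ?inE// => w /=; lra.
Qed.

Hypothesis cndN : is_CND f N.

Let cF : continuous F. Proof. by case: cndN. Qed.
Let sF x : F x = 1 - F (- x). Proof. by case: cndN. Qed.
Let F01 x : 0 <= F x <= 1. Proof. exact: rcdf01. Qed.
Let F_lt x y : F x < F y -> x < y.
Proof.
by move=> h; rewrite ltNge; apply/negP => /(rcdf_homo N); rewrite leNgt h.
Qed.

Let fF a : 0 < a < 1 -> f a = F (quantile F a - 1).
Proof. by case: cndN => _ _ e1 e2 _ a01; rewrite e1// e2. Qed.

Lemma CND_le x : f (F x) <= F (x - 1).
Proof.
apply: ray_tradeoff => a a01.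
by case: cndN => _ h _ _ _; apply: h => //; rewrite ler01 lexx.
Qed.

(* The quantile [q] of [F x] may lie strictly left of [x]. If [F] increased
   between [q - 1] and [x - 1], then by symmetry it would also do so between
   [1 - x] and [1 - q], while being constant on [[-x, -q]], so that [f] would
   take the same positive value twice. *)
Lemma CND_eq x : F x < 1 -> f (F x) = F (x - 1).
Proof.
move=> Fx1; apply/le_anti; rewrite CND_le/=.
have [Fx0|Fx0] := leP (F x) 0.
  have : F (x - 1) <= F x by apply: rcdf_homo; lra.
  by have := rt_ge0 rf (F01 x); lra.
have a01 : 0 < F x < 1 by rewrite Fx0 Fx1.
rewrite leNgt; apply/negP => h.
have [Fq qle] := continuous_quantile cF a01.
have fa := fF a01; set q := quantile F (F x) in Fq qle fa.
have Fxx : F (x - 1) <= F x by apply: rcdf_homo; lra.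
have fa0 := rt_ge0 rf (F01 x).
have const g : f (F x) < g < F (x - 1) -> f (1 - g) = 1 - F x.
  move=> /andP[g1 g2].
  have g01 : 0 < 1 - g < 1 by lra.
  have [Fw _] := continuous_quantile cF g01.
  rewrite (fF g01); set w := quantile F (1 - g) in Fw *.
  have w1 : 1 - x < w by apply: F_lt; rewrite Fw (sF (1 - x)) opprB; lra.
  have w2 : w < 1 - q by apply: F_lt; rewrite Fw (sF (1 - q)) opprB -fa; lra.
  have : F (- x) <= F (w - 1) by apply: rcdf_homo; lra.
  have : F (w - 1) <= F (- q) by apply: rcdf_homo; lra.
  have := sF x; have := sF q; rewrite Fq; lra.
(* Any two distinct points strictly between [f (F x)] and [F (x - 1)] would do: [f] takes the
   positive value [1 - F x] at both complements. *)
pose g1 := (2 * f (F x) + F (x - 1)) / 3.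
pose g2 := (f (F x) + 2 * F (x - 1)) / 3.
have e1 : f (1 - g1) = 1 - F x by apply: const; rewrite /g1; lra.
have e2 : f (1 - g2) = 1 - F x by apply: const; rewrite /g2; lra.
have := @rt_inj_pos _ _ rf (1 - g2) (1 - g1).
rewrite e1 e2 => /(_ _ _ _ erefl) z.
have := z ltac:(rewrite /g2; lra) ltac:(rewrite /g1 /g2; lra) ltac:(rewrite /g1; lra).
lra.
Qed.

Lemma round_CND : is_discrete_CND f 1 (rv_round N).
Proof.
have Fr t : rcdf (rv_round N) t%:~R = F (t%:~R + 2^-1).
  apply: EFin_inj; rewrite rcdfK -continuous_rcdf_lt//; congr (P _).
  have E w : (rv_round N w <= t%:~R) = (N w < t%:~R + 2^-1).
    rewrite -[rv_round N w]/((Num.floor (N w + 2^-1))%:~R).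
    by rewrite ler_int -ltzD1 floor_lt_int intrD; apply/idP/idP; lra.
  by apply/seteqP; split => w; rewrite /mkset E.
apply: discrete_CND_intro => //.
- by apply: aeW => w; exact: intr_int.
(* The reflection of [t + 1/2] is [(- t - 1) + 1/2], whence the offset in the discrete symmetry. *)
- move=> t; rewrite !Fr sF; congr (1 - F _).
  by rewrite intrB intrN; lra.
- move=> t; rewrite !Fr.
  have -> : t%:~R + 2^-1 = (t + 1)%:~R + 2^-1 - 1 :> R by rewrite intrD; lra.
  exact: CND_le.
- move=> t; rewrite !Fr => h.
  have -> : t%:~R + 2^-1 = (t + 1)%:~R + 2^-1 - 1 :> R by rewrite intrD; lra.
  exact: CND_eq.
Qed.

End ContinuousCND.

(** * Probabilities on the naturals with given masses *)

Section NatMeasure.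
Variables (R : realType) (p : nat -> R).
Hypotheses (p0 : forall n, 0 <= p n).

(* The unused argument lets canonical structure inference find the proof that
   the total mass is 1. *)
Definition nat_measure of (\sum_(n <oo) (p n)%:E = 1)%E : set nat -> \bar R :=
  mseries (fun n => mscale (NngNum (p0 n)) (@dirac _ nat n R)) 0.

Hypothesis p1 : (\sum_(n <oo) (p n)%:E = 1)%E.

HB.instance Definition _ := Measure.copy (nat_measure p1)
  (mseries (fun n => mscale (NngNum (p0 n)) (@dirac _ nat n R)) 0).

Let nat_measure_setT : nat_measure p1 setT = 1%E.
Proof.
rewrite -p1; apply: eq_eseriesr => n _.
by rewrite -[LHS]/((p n)%:E * \d_n setT)%E diracT mule1.
Qed.

HB.instance Definition _ :=
  Measure_isProbability.Build _ _ _ (nat_measure p1) nat_measure_setT.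

Lemma nat_measure1 n : nat_measure p1 [set n] = (p n)%:E.
Proof.
transitivity (\sum_(k <oo) ((p k)%:E * \d_k [set n]))%E; first by [].
rewrite (@nneseriesD1 _ _ n)//; last by move=> k _; rewrite mule_ge0// lee_fin.
rewrite diracE mem_set// mule1 eseries0 ?adde0// => k _ kn.
by rewrite diracE memNset ?mule0//= => nk; rewrite nk eqxx in kn.
Qed.

End NatMeasure.

(** * Existence of a discrete CND *)

Section Existence.
Variables (R : realType) (f : R -> R).
Hypotheses (rf : regular_tradeoff f) (nt : nontrivial_tradeoff f).

Let c := c_of f.

Let c01 : 0 <= c <= 1.
Proof. by have [x x01 fx] := rt_fix_exists rf; rewrite /c (rt_c_of rf x01 fx). Qed.

Let fc : f (1 - c) = c.
Proof. by have [x x01 fx] := rt_fix_exists rf; rewrite /c (rt_c_of rf x01 fx). Qed.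

Let c1 : c < 1.
Proof.
have := @rt_le_id _ _ rf (1 - c); rewrite fc => /(_ _); have := c01; lra.
Qed.

(** The intended value of the cdf at [- k]. *)
Let y k := iter k f (1 - c).

Let y01 k : 0 <= y k <= 1.
Proof.
by have := @rt_iter01 _ _ rf k (1 - c); have := c01; rewrite -/(y k); lra.
Qed.

Let yS k : y k.+1 = f (y k). Proof. by []. Qed.

Let y_le k : y k.+1 <= y k. Proof. by rewrite yS; exact: rt_le_id. Qed.

Let y_cvg e : 0 < e -> exists k, y k < e.
Proof.
move=> e0; have c1' : 0 <= c < 1 by have := c01; have := c1; lra.
have [k hk] := rt_iter_cvg0 rf nt c1' e0.
by exists k.+1; rewrite /y iterSr fc.
Qed.

Let q (k : int) := y `|k|%N - y `|k|%N.+1.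
Let p n := q (int_enum n).

Let p0 n : 0 <= p n. Proof. by rewrite subr_ge0. Qed.

(** The masses from [-m] to [m] telescope on each side of 0; the central one is [1 - 2 * c], with
    [c = y 1]. *)
Let p_sum m : \sum_(0 <= n < m.*2.+1) p n = 1 - y m.+1 *+ 2.
Proof.
elim: m => [|m IH].
  by rewrite big_nat1 -[p 0]/((1 - c) - f (1 - c)) (yS 0) -[y 0]/(1 - c) fc; lra.
rewrite doubleS big_nat_recr// big_nat_recr// IH /p.
have -> : int_enum m.*2.+1 = Negz m by rewrite -[RHS]int_codeK.
have -> : int_enum m.*2.+2 = Posz m.+1 by rewrite -[RHS]int_codeK.
rewrite /q /=; lra.
Qed.

Let p1 : (\sum_(n <oo) (p n)%:E = 1)%E.
Proof.
apply/le_anti/andP; split.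
  apply: lime_le; first by apply: is_cvg_nneseries => n _ _; rewrite lee_fin.
  apply: nearW => m; apply: (@le_trans _ _ (\sum_(0 <= n < m.*2.+1) (p n)%:E)%E).
    apply: lee_sum_nneg_natr => //; last by rewrite -addnn -addnS leq_addr.
    by move=> n _ _; rewrite lee_fin.
  by rewrite sumEFin p_sum lee_fin; have := y01 m.+1; lra.
apply/lee_addgt0Pr => e e0.
have [k hk] := @y_cvg (e / 2) ltac:(lra).
apply: (@le_trans _ _ (\sum_(0 <= n < k.*2.+1) (p n)%:E + e%:E)%E).
  by rewrite sumEFin p_sum -EFinD lee_fin; have := y_le k; lra.
by rewrite leeD2r// nneseries_lim_ge// => n _ _; rewrite lee_fin.
Qed.

Let P : probability nat R := nat_measure p0 p1.

Let mN : measurable_fun [set: nat] (fun n => (int_enum n)%:~R : R).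
Proof. by []. Qed.

Let N : {RV P >-> R} := mfun_Sub (mem_set mN).

Lemma discrete_CND_exists : exists (d : measure_display) (T : measurableType d)
  (P : probability T R) (N : {RV P >-> R}), is_discrete_CND f 1 N.
Proof.
have hN : int_valued N by apply: aeW => n; exact: intr_int.
have pmfN k : pmf N k%:~R = q k.
  apply: EFin_inj; rewrite pmfK.
  have -> : N @^-1` [set k%:~R] = [set int_code k].
    apply/seteqP; split => n /=.
      by move=> /eqP; rewrite eqr_int => /eqP <-; rewrite int_enumK.
    move=> ->; change ((int_enum (int_code k))%:~R = k%:~R :> R).
    by rewrite int_codeK.
  by rewrite [LHS](nat_measure1 p0 p1) /p int_codeK.
have dN : same_distribution N (rv_opp N).
  apply: int_valued_same_distribution => //; first exact: int_valued_opp.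
  by move=> k; rewrite pmf_opp -intrN !pmfN /q abszN.
pose F (t : int) := rcdf N t%:~R.
have sF t : F t = 1 - F (- t - 1) by exact: int_valued_symmetric_rcdf.
(* The masses fix only the increments of [F], hence [F (- k) - y k] up to a constant, which is 0
   because both terms tend to 0. *)
have dF k : F (- k%:Z) - y k = F 0 - y 0.
  elim: k => [|k <-]; first by rewrite oppr0.
  have := int_valued_pmf (- k%:Z) hN.
  rewrite pmfN /q abszN absz_nat -/(F _) -/(F (- k%:Z - 1)).
  have -> : - k%:Z - 1 = - k.+1%:Z by lia.
  lra.
have F0 : F 0 = y 0.
  apply/le_anti/andP; split; rewrite leNgt; apply/negP => h.
    have [j hj] := @rcdf_lt _ _ _ _ N (F 0 - y 0) ltac:(lra).
    have : F (- `|j|%N%:Z) <= F j by apply: rcdf_homo; rewrite ler_int; lia.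
    by have := dF `|j|%N; have := y01 `|j|%N; rewrite /F in hj *; lra.
  have [k hk] := @y_cvg (y 0 - F 0) ltac:(lra).
  have : 0 <= F (- k%:Z) <= 1 by exact: rcdf01.
  by have := dF k; lra.
have {F0}Fy k : F (- k%:Z) = y k by have := dF k; lra.
have F_neg k : F (- k%:Z - 1) = y k.+1.
  by rewrite -Fy; congr F; lia.
exists _, nat, P, N.
apply: discrete_CND_intro => // t; rewrite -/(F t) -/(F (t + 1)).
(* For [t >= 0], symmetry gives [F t = 1 - y t.+1], so the recurrence becomes a statement on
   [f (1 - f z)] at [z = y t.+1]; for [t < 0] it is the definition of [y]. *)
- case: t => [m|k].
  + rewrite (sF m) (sF (m%:Z + 1)).
    have -> : - (m%:Z + 1) - 1 = - m.+1%:Z - 1 by lia.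
    by rewrite !F_neg yS; exact: rt_inv_le.
  + have -> : Negz k + 1 = - k%:Z by lia.
    have -> : Negz k = - k.+1%:Z by lia.
    by rewrite !Fy.
- case: t => [m|k].
  + rewrite (sF m) (sF (m%:Z + 1)).
    have -> : - (m%:Z + 1) - 1 = - m.+1%:Z - 1 by lia.
    (* Here [F (t + 1) < 1] says exactly that [f (y m.+1)] is positive. *)
    rewrite !F_neg yS => h; apply: rt_inv_eq => //; lra.
  + have -> : Negz k + 1 = - k%:Z by lia.
    have -> : Negz k = - k.+1%:Z by lia.
    by rewrite !Fy.
Qed.
End Existence.

Theorem proposition20 (R : realType) (f : R -> R)
  (f_tradeoff : is_tradeoff f) (f_sym : symmetric_tradeoff f)
  (f_nontrivial : nontrivial_tradeoff f) :
  [/\ (* existence *)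
      exists (d : measure_display) (T : measurableType d) (P : probability T R)
             (N : {RV P >-> R}), is_discrete_CND f 1 N,
      (* uniqueness in law *)
      forall (d : measure_display) (T : measurableType d) (P : probability T R)
             (N : {RV P >-> R})
             (d' : measure_display) (T' : measurableType d')
             (P' : probability T' R) (N' : {RV P' >-> R}),
        is_discrete_CND f 1 N -> is_discrete_CND f 1 N' ->
        same_distribution N N',
      (* realization by rounding any continuous CND *)
      forall (d : measure_display) (T : measurableType d) (P : probability T R)
             (Nc : {RV P >-> R}),
        is_CND f Nc -> is_discrete_CND f 1 (rv_round Nc)
    & (* probability mass function *)
      forall (d : measure_display) (T : measurableType d) (P : probability T R)
             (N : {RV P >-> R}),
        is_discrete_CND f 1 N ->
        forall x : int,
          pmf N x%:~R =
            iter `|x|%N f (1 - c_of f) - iter `|x|%N f (c_of f)].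
Proof.
have rf := symmetric_tradeoff_regular f_tradeoff f_sym.
split.
- exact: discrete_CND_exists.
- move=> d T P N d' T' P' N' hN hN'.
  apply: int_valued_same_distribution; [by case: hN|by case: hN'|] => k.
  by rewrite !(@discrete_CND_pmf _ f).
- by move=> d T P Nc; exact: round_CND.
- by move=> d T P N hN x; exact: discrete_CND_pmf.
Qed.
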